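(* Let $G$ be a group. If $B=\bigoplus_{t\in G}B_t$ is an idempotent $G$-graded algebra, then $B$ and $(B\#G)\rtimes_{\beta^B}G$ are graded-equivalent.
   Context: Algebras are associative, not necessarily unital, over a fixed commutative associative unital ring $k$; $G$ is an arbitrary group. Products of subsets such as $UV$ denote the $k$-span of all products $uv$. An algebra $A$ is idempotent if $A^2=A$. A $G$-graded algebra is $B=\bigoplus_{t\in G}B_t$ with $B_sB_t\subseteq B_{st}$. A left $A$-module $M$ is unital if $AM=M$; an $(A,B)$-bimodule $X$ is unital if $AX=X=XB$. Smash product: $B\#G:=\bigoplus_{r,s\in G}B_{r^{-1}s}e_{r,s}$, a subalgebra of the algebra of $G\times G$-matrices over $B$ with finitely many nonzero entries ($b\,e_{r,s}$ is the matrix with $b$ at position $(r,s)$ and $0$ elsewhere). The action $\beta^B$ of $G$ on $B\#G$ is $\beta^B_t(b\,e_{r,s})=b\,e_{tr,ts}$. The skew group algebra is $(B\#G)\rtimes_{\beta^B}G=\bigoplus_{t\in G}(B\#G)\delta_t$ with $(c\delta_s)(d\delta_t)=c\,\beta^B_s(d)\delta_{st}$, graded with $(B\#G)\delta_t$ in degree $t$. A Morita context $(A,B,X,Y,\tau_A,\tau_B)$ consists of algebras $A,B$, an $(A,B)$-bimodule $X$, a $(B,A)$-bimodule $Y$, an $A$-bimodule map $\tau_A:X\otimes_BY\to A$ and a $B$-bimodule map $\tau_B:Y\otimes_AX\to B$ with $\tau_A(x\otimes y)x'=x\tau_B(y\otimes x')$ and $\tau_B(y\otimes x)y'=y\tau_A(x\otimes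 y')$. It is a graded Morita context between idempotent $G$-graded algebras $A,B$ if $X=\bigoplus_tX_t$, $Y=\bigoplus_tY_t$ are $G$-graded bimodules, and $\tau_A(X_r\otimes_B Y_s)\subseteq A_{rs}$, $\tau_B(Y_r\otimes_A X_s)\subseteq B_{rs}$ for all $r,s\in G$. Two idempotent $G$-graded algebras are graded-equivalent if there is a graded Morita context between them with unital bimodules $X,Y$ and surjective $\tau_A,\tau_B$. *)

(* Defs.v *)
From HB Require Import structures.
From mathcomp Require Import all_boot all_order all_algebra finmap.
From mathcomp Require Import boolp.

Set Implicit Arguments.
Unset Strict Implicit.
Unset Printing Implicit Defensive.

Import GRing.Theory.
Local Open Scope ring_scope.

(* The direct sum of I copies of V. *)
Definition dirsum (I : choiceType) (V : zmodType) := {fsfun I -> V with 0}.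

HB.instance Definition _ I V := Choice.on (dirsum I V).

Section DirsumZmod.
Variables (I : choiceType) (V : zmodType).
Implicit Types f g h : dirsum I V.

Lemma dsP f g : f =1 g <-> f = g.
Proof. exact: fsfunP. Qed.

Lemma ds_out f i : i \notin finsupp f -> f i = 0.
Proof. exact: fsfun_dflt. Qed.

Definition ds_mk (S : {fset I}) (F : I -> V) : dirsum I V :=
  [fsfun i in S => F i | 0].

Lemma ds_mkE S F i : ds_mk S F i = if i \in S then F i else 0.
Proof. by rewrite /ds_mk fsfunE. Qed.

Definition ds_zero : dirsum I V := ds_mk fset0 (fun=> 0).
Definition ds_opp f := ds_mk (finsupp f) (fun i => - f i).
Definition ds_add f g :=
  ds_mk (finsupp f `|` finsupp g)%fset (fun i => f i + g i).

Lemma ds_zeroE i : ds_zero i = 0.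
Proof. by rewrite ds_mkE inE. Qed.

Lemma ds_oppE f i : ds_opp f i = - f i.
Proof. by rewrite ds_mkE; case: ifPn => // /ds_out ->; rewrite oppr0. Qed.

Lemma ds_addE f g i : ds_add f g i = f i + g i.
Proof.
rewrite ds_mkE; case: ifPn => //; rewrite inE negb_or.
by case/andP => /ds_out -> /ds_out ->; rewrite addr0.
Qed.

Fact ds_addA : associative ds_add.
Proof. by move=> f g h; apply/dsP => i; rewrite !ds_addE addrA. Qed.
Fact ds_addC : commutative ds_add.
Proof. by move=> f g; apply/dsP => i; rewrite !ds_addE addrC. Qed.
Fact ds_add0 : left_id ds_zero ds_add.
Proof. by move=> f; apply/dsP => i; rewrite ds_addE ds_zeroE add0r. Qed.
Fact ds_addN : left_inverse ds_zero ds_opp ds_add.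
Proof. by move=> f; apply/dsP => i; rewrite ds_addE ds_oppE ds_zeroE addNr. Qed.

HB.instance Definition _ :=
  GRing.isZmodule.Build (dirsum I V) ds_addA ds_addC ds_add0 ds_addN.

Lemma ds0E i : (0 : dirsum I V) i = 0. Proof. exact: ds_zeroE. Qed.
Lemma dsNE f i : (- f) i = - f i. Proof. exact: ds_oppE. Qed.
Lemma dsDE f g i : (f + g) i = f i + g i. Proof. exact: ds_addE. Qed.

Lemma ds_sumE T (r : seq T) (P : pred T) (F : T -> dirsum I V) i :
  (\sum_(t <- r | P t) F t) i = \sum_(t <- r | P t) F t i.
Proof.
apply: (big_morph (fun f : dirsum I V => f i)) => [f g|]; [exact: dsDE|exact: ds0E].
Qed.

Definition ds1 (i : I) (v : V) : dirsum I V := ds_mk [fset i]%fset (fun=> v).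

Lemma ds1E i v j : ds1 i v j = if j == i then v else 0.
Proof. by rewrite ds_mkE inE. Qed.

Lemma finsupp_ds1 i v : (finsupp (ds1 i v) `<=` [fset i])%fset.
Proof.
apply/fsubsetP => j; rewrite mem_finsupp ds1E inE.
by case: (j =P i); rewrite ?eqxx.
Qed.

Lemma ds1D i v w : ds1 i (v + w) = ds1 i v + ds1 i w.
Proof.
by apply/dsP => j; rewrite dsDE !ds1E; case: eqP; rewrite ?addr0.
Qed.

Lemma ds10 i : ds1 i 0 = 0.
Proof. by apply/dsP => j; rewrite ds0E !ds1E if_same. Qed.

Lemma ds_sum1 (S : {fset I}) f : (finsupp f `<=` S)%fset ->
  f = \sum_(i <- S) ds1 i (f i).
Proof.
move=> sfS; apply/dsP => j; rewrite ds_sumE.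
have [jS|jS] := boolP (j \in S).
  rewrite (big_fsetD1 j) //= ds1E eqxx big1_fset ?addr0 // => i.
  by rewrite !inE => /andP [/negPf ij _] _; rewrite ds1E eq_sym ij.
rewrite big1_fset => [|i iS _]; last first.
  by rewrite ds1E; case: eqP => // ji; rewrite ji iS in jS.
by apply: ds_out; apply: contra jS => /(fsubsetP sfS).
Qed.

End DirsumZmod.

Section DirsumLmod.
Variables (k : pzRingType) (I : choiceType) (V : lmodType k).
Implicit Types f g : dirsum I V.

Definition ds_scale (c : k) f := ds_mk (finsupp f) (fun i => c *: f i).

Lemma ds_scaleE c f i : ds_scale c f i = c *: f i.
Proof. by rewrite ds_mkE; case: ifPn => // /ds_out ->; rewrite scaler0. Qed.

Fact ds_scaleA a b f : ds_scale a (ds_scale b f) = ds_scale (a * b) f.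
Proof. by apply/dsP => i; rewrite !ds_scaleE scalerA. Qed.
Fact ds_scale1 : left_id 1 ds_scale.
Proof. by move=> f; apply/dsP => i; rewrite ds_scaleE scale1r. Qed.
Fact ds_scaleDr : right_distributive ds_scale +%R.
Proof.
by move=> c f g; apply/dsP => i; rewrite ?(ds_scaleE, dsDE) scalerDr.
Qed.
Fact ds_scaleDl f : {morph ds_scale^~ f : a b / a + b}.
Proof.
by move=> a b; apply/dsP => i; rewrite ?(ds_scaleE, dsDE) scalerDl.
Qed.

HB.instance Definition _ := GRing.Zmodule_isLmodule.Build k (dirsum I V)
  ds_scaleA ds_scale1 ds_scaleDr ds_scaleDl.

Lemma dsZE c f i : (c *: f) i = c *: f i. Proof. exact: ds_scaleE. Qed.

Lemma ds1Z i c v : ds1 i (c *: v) = c *: ds1 i v :> dirsum I V.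
Proof. by apply/dsP => j; rewrite dsZE !ds1E; case: eqP; rewrite ?scaler0. Qed.

End DirsumLmod.

Section DirsumLin.
Variables (k : pzRingType) (I : choiceType) (V W : lmodType k).
Variable F : I -> V -> W.

(* The linear extension of a family of linear maps F i : V -> W. *)
Definition ds_lin (f : dirsum I V) : W := \sum_(i <- finsupp f) F i (f i).

Hypothesis linF : forall i, linear (F i).

Let F0 i : F i 0 = 0.
Proof. by have := linF i (-1) 0 0; rewrite scaler0 addr0 scaleN1r addNr. Qed.

Lemma ds_linE (S : {fset I}) f : (finsupp f `<=` S)%fset ->
  ds_lin f = \sum_(i <- S) F i (f i).
Proof.
move=> sfS; rewrite /ds_lin.
apply: big_fset_incl => //= i iS ifS.
by rewrite ds_out // F0.
Qed.

Lemma ds_lin_is_linear : linear ds_lin.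
Proof.
move=> c f g; pose S := (finsupp f `|` finsupp g `|` finsupp (c *: f + g)%R)%fset.
have sf : (finsupp f `<=` S)%fset by rewrite /S -fsetUA fsubsetUl.
have sg : (finsupp g `<=` S)%fset by rewrite /S fsetUAC fsubsetUr.
have sfg : (finsupp (c *: f + g)%R `<=` S)%fset by rewrite /S fsubsetUr.
rewrite (ds_linE sf) (ds_linE sg) (ds_linE sfg).
rewrite scaler_sumr -big_split /=; apply: eq_bigr => i _.
by rewrite dsDE dsZE linF.
Qed.

Lemma ds_lin1 i v : ds_lin (ds1 i v) = F i v.
Proof.
by rewrite (ds_linE (finsupp_ds1 i v)) big_seq_fset1 ds1E eqxx.
Qed.

End DirsumLin.

Lemma ds_linear_ext (k : pzRingType) (I : choiceType) (V W : lmodType k)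
    (u v : dirsum I V -> W) : linear u -> linear v ->
  (forall i x, u (ds1 i x) = v (ds1 i x)) -> u =1 v.
Proof.
move=> lu lv uv f.
pose lu' := GRing.isLinear.Build k (dirsum I V) W _ u lu.
pose lv' := GRing.isLinear.Build k (dirsum I V) W _ v lv.
pose U : {linear dirsum I V -> W} := HB.pack u lu'.
pose U' : {linear dirsum I V -> W} := HB.pack v lv'.
rewrite -[u f]/(U f) -[v f]/(U' f).
rewrite (ds_sum1 (fsubset_refl (finsupp f))) !linear_sum.
by apply: eq_bigr => i _; exact: uv.
Qed.

Section DirsumBilinear.
Variables (k : comPzRingType) (I J : choiceType) (U V W : lmodType k).
Variable F : I -> J -> U -> V -> W.

(* The bilinear extension of a family of bilinear maps F i j : U * V -> W. *)
Definition ds_bil (f : dirsum I U) (g : dirsum J V) : W :=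
  ds_lin (fun i u => ds_lin (fun j v => F i j u v) g) f.

Hypothesis Fl : forall i j v, linear (fun u => F i j u v).
Hypothesis Fr : forall i j u, linear (F i j u).

Let inner_linear g i : linear (fun u => ds_lin (fun j v => F i j u v) g).
Proof.
move=> c u u'; rewrite /ds_lin scaler_sumr -big_split /=.
by apply: eq_bigr => j _; rewrite Fl.
Qed.

Lemma ds_bil_linl g : linear (ds_bil^~ g).
Proof. exact: ds_lin_is_linear (inner_linear g). Qed.

Lemma ds_bil_linr f : linear (ds_bil f).
Proof.
move=> c g g'; rewrite /ds_bil {1 2 4}/ds_lin scaler_sumr -big_split /=.
apply: eq_bigr => i _.
exact: (@ds_lin_is_linear _ _ _ _ (fun j => F i j (f i)) (fun j => Fr i j _)).
Qed.

Lemma ds_bil1 i j u v : ds_bil (ds1 i u) (ds1 j v) = F i j u v.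
Proof.
rewrite /ds_bil (ds_lin1 (inner_linear _)).
exact: (@ds_lin1 _ _ _ _ (fun j => F i j u) (fun j => Fr i j u)).
Qed.

End DirsumBilinear.

Section Span.
Variables (k : comPzRingType) (V : lmodType k).

Definition span (S : V -> Prop) (v : V) : Prop :=
  exists r : seq (k * V),
    (forall c, c \in r -> S c.2) /\ v = \sum_(c <- r) c.1 *: c.2.

Lemma span_gen (S : V -> Prop) v : S v -> span S v.
Proof.
move=> Sv; exists [:: (1, v)]; split; last by rewrite big_seq1 scale1r.
by move=> c; rewrite inE => /eqP ->.
Qed.

Lemma span0 S : span S 0.
Proof. by exists [::]; split=> //; rewrite big_nil. Qed.

Lemma spanD S u v : span S u -> span S v -> span S (u + v).
Proof.
move=> [r [rS ->]] [r' [rS' ->]]; exists (r ++ r'); rewrite big_cat; split=> //.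
by move=> c; rewrite mem_cat => /orP [/rS|/rS'].
Qed.

Lemma spanZ S c v : span S v -> span S (c *: v).
Proof.
move=> [r [rS ->]]; exists [seq (c * e.1, e.2) | e <- r]; split.
  by move=> _ /mapP [e /rS Se ->].
by rewrite scaler_sumr big_map; apply: eq_bigr => e _; rewrite scalerA.
Qed.

End Span.

(* The k-span of all the values of a product (multiplication or action). *)
Definition products (k : comPzRingType) (U V : Type) (W : lmodType k)
    (op : U -> V -> W) : W -> Prop :=
  span (fun w => exists u v, w = op u v).

(* Nonunital algebras: the product is that of the semigroup structure. *)
HB.mixin Record Semigroup_isNuAlgebra (k : comPzRingType) A
    of GRing.Lmodule k A & Semigroup A := {
  nu_linl : forall b : A, linear (fun a : A => (a * b)%g);
  nu_linr : forall a : A, linear (fun b : A => (a * b)%g)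
}.

#[short(type="nuAlgType")]
HB.structure Definition NuAlgebra (k : comPzRingType) :=
  {A of GRing.Lmodule k A & Semigroup A & Semigroup_isNuAlgebra k A}.

Definition idempotent_alg (k : comPzRingType) (A : nuAlgType k) : Prop :=
  forall a : A, products (fun x y : A => (x * y)%g) a.

HB.mixin Record Lmodule_isBimodule (k : comPzRingType) (A B : nuAlgType k) X
    of GRing.Lmodule k X := {
  lact : A -> X -> X;
  ract : X -> B -> X;
  lact_linl : forall x : X, linear (fun a : A => lact a x);
  lact_linr : forall a : A, linear (fun x : X => lact a x);
  ract_linl : forall b : B, linear (fun x : X => ract x b);
  ract_linr : forall x : X, linear (fun b : B => ract x b);
  lactA : forall (a a' : A) (x : X), lact (a * a')%g x = lact a (lact a' x);
  ractA : forall (x : X) (b b' : B), ract x (b * b')%g = ract (ract x b) b';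
  lractA : forall (a : A) (x : X) (b : B),
    ract (lact a x) b = lact a (ract x b)
}.

#[short(type="bimodType")]
HB.structure Definition Bimodule (k : comPzRingType) (A B : nuAlgType k) :=
  {X of GRing.Lmodule k X & Lmodule_isBimodule k A B X}.

Definition unital_bimod (k : comPzRingType) (A B : nuAlgType k)
    (X : bimodType A B) : Prop :=
  (forall x : X, products (fun (a : A) (y : X) => lact a y) x) /\
  (forall x : X, products (fun (y : X) (b : B) => ract y b) x).

Section Tensor.
Variables (k : comPzRingType) (A B C : nuAlgType k).
Variables (X : bimodType A B) (Y : bimodType B C).

(* The free k-module on the underlying set of X * Y. *)
Definition tens_free := dirsum (X * Y)%type k^o.

HB.instance Definition _ := GRing.Lmodule.on tens_free.

Definition tens_gen (x : X) (y : Y) : tens_free := ds1 (x, y) (1 : k^o).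

Inductive tens_rel : tens_free -> Prop :=
| tens_rel_Dl x x' y :
    tens_rel (tens_gen (x + x') y - (tens_gen x y + tens_gen x' y))
| tens_rel_Dr x y y' :
    tens_rel (tens_gen x (y + y') - (tens_gen x y + tens_gen x y'))
| tens_rel_Zl c x y : tens_rel (tens_gen (c *: x) y - c *: tens_gen x y)
| tens_rel_Zr c x y : tens_rel (tens_gen x (c *: y) - c *: tens_gen x y)
| tens_rel_bal x (b : B) y :
    tens_rel (tens_gen (ract x b) y - tens_gen x (lact b y)).

Definition tens_null : {pred tens_free} := fun v => `[< span tens_rel v >].

Fact tens_null_closed : subsemimod_closed tens_null.
Proof.
split; first split.
- exact/asboolP/span0.
- by move=> u v /asboolP su /asboolP sv; apply/asboolP/spanD.
- by move=> c v /asboolP sv; apply/asboolP/spanZ.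
Qed.

HB.instance Definition _ :=
  GRing.isSubmodClosed.Build k tens_free tens_null tens_null_closed.

Definition tensor := Quotient.quot tens_null.

HB.instance Definition _ := GRing.Zmodule.on tensor.

Local Open Scope quotient_scope.

Definition tens_pi (v : tens_free) : tensor := \pi_(Quotient.quot tens_null) v.

Lemma tens_piD u v : tens_pi (u + v) = tens_pi u + tens_pi v.
Proof. exact: raddfD. Qed.

Lemma tens_piP u v : (u - v \in tens_null) = (tens_pi u == tens_pi v).
Proof. by rewrite Quotient.idealrBE. Qed.

Lemma tens_pi_surj (t : tensor) : exists v, t = tens_pi v.
Proof. by exists (repr t); rewrite /tens_pi reprK. Qed.

Definition tens_scale (c : k) (t : tensor) : tensor :=
  tens_pi (c *: (repr (t : Quotient.quot tens_null) : tens_free)).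

Lemma tens_scale_pi c v : tens_scale c (tens_pi v) = tens_pi (c *: v).
Proof.
apply/eqP; rewrite -tens_piP -scalerBr rpredZ // tens_piP.
by rewrite /tens_pi reprK.
Qed.

Fact tens_scaleA a b t : tens_scale a (tens_scale b t) = tens_scale (a * b) t.
Proof. by case: (tens_pi_surj t) => v ->; rewrite !tens_scale_pi scalerA. Qed.
Fact tens_scale1 : left_id 1 tens_scale.
Proof.
by move=> t; case: (tens_pi_surj t) => v ->; rewrite tens_scale_pi scale1r.
Qed.
Fact tens_scaleDr : right_distributive tens_scale +%R.
Proof.
move=> c t u; case: (tens_pi_surj t) (tens_pi_surj u) => v -> [w ->].
by rewrite -tens_piD !tens_scale_pi scalerDr tens_piD.
Qed.
Fact tens_scaleDl t : {morph tens_scale^~ t : a b / a + b}.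
Proof.
move=> a b; case: (tens_pi_surj t) => v ->.
by rewrite !tens_scale_pi scalerDl tens_piD.
Qed.

HB.instance Definition _ := GRing.Zmodule_isLmodule.Build k tensor
  tens_scaleA tens_scale1 tens_scaleDr tens_scaleDl.

Lemma tens_pi_linear : linear tens_pi.
Proof. by move=> c u v; rewrite tens_piD -tens_scale_pi. Qed.

Definition tens (x : X) (y : Y) : tensor := tens_pi (tens_gen x y).

Lemma tens_relE u v : tens_rel (u - v) -> tens_pi u = tens_pi v.
Proof.
by move=> r; apply/eqP; rewrite -tens_piP; apply/asboolP/span_gen.
Qed.

Lemma tens_linl y : linear (fun x => tens x y).
Proof.
move=> c x x'; rewrite /tens -tens_pi_linear.
rewrite (tens_relE (tens_rel_Dl _ _ _)) !tens_piD.
by rewrite (tens_relE (tens_rel_Zl _ _ _)).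
Qed.

Lemma tens_linr x : linear (tens x).
Proof.
move=> c y y'; rewrite /tens -tens_pi_linear.
rewrite (tens_relE (tens_rel_Dr _ _ _)) !tens_piD.
by rewrite (tens_relE (tens_rel_Zr _ _ _)).
Qed.

Lemma tens_bal x (b : B) y : tens (ract x b) y = tens x (lact b y).
Proof. exact: tens_relE (tens_rel_bal _ _ _). Qed.

Lemma tens_linear_ext (W : lmodType k) (u v : tensor -> W) :
  linear u -> linear v -> (forall x y, u (tens x y) = v (tens x y)) -> u =1 v.
Proof.
move=> lu lv uv t; case: (tens_pi_surj t) => w ->.
apply: (@ds_linear_ext _ _ _ _ (fun w => u (tens_pi w)) (fun w => v (tens_pi w))).
- by move=> c a b /=; rewrite tens_pi_linear lu.
- by move=> c a b /=; rewrite tens_pi_linear lv.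
case=> x y c; have -> : ds1 (x, y) c = c *: tens_gen x y.
  by rewrite -ds1Z; congr ds1; rewrite /GRing.scale /= mulr1.
have piZ w' : tens_pi (c *: w') = c *: tens_pi w' by rewrite -tens_scale_pi.
have linZ f : linear f -> forall w', f (c *: w') = c *: f w' :> W.
  move=> lf w'; have f0 : f 0 = 0.
    by have := lf (-1) 0 0; rewrite scaler0 addr0 scaleN1r addNr.
  by have := lf c w' 0; rewrite !addr0 f0 addr0.
by rewrite piZ !linZ // [X in c *: X]uv.
Qed.

Section Lift.
Variables (W : lmodType k) (F : X -> Y -> W).
Hypothesis Fl : forall y, linear (fun x => F x y).
Hypothesis Fr : forall x, linear (F x).
Hypothesis Fbal : forall x (b : B) y, F (ract x b) y = F x (lact b y).

Let lift0 : tens_free -> W := ds_lin (fun p (c : k^o) => c *: F p.1 p.2).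

Let lift0_linear : linear lift0.
Proof.
apply: ds_lin_is_linear => p c a b.
by rewrite scalerDl scalerA.
Qed.

Let lift0_gen x y : lift0 (tens_gen x y) = F x y.
Proof.
rewrite /lift0 /tens_gen ds_lin1 ?scale1r // => p c a b.
by rewrite scalerDl scalerA.
Qed.

Let lift0B u v : lift0 (u - v) = lift0 u - lift0 v.
Proof. by have := lift0_linear (-1) v u; rewrite !scaleN1r ![- _ + _]addrC.
Qed.

Let lift0_0 : lift0 0 = 0.
Proof. by have := lift0B 0 0; rewrite !subrr. Qed.

Let lift0D u v : lift0 (u + v) = lift0 u + lift0 v.
Proof. by have := lift0_linear 1 u v; rewrite !scale1r. Qed.

Let lift0Z c u : lift0 (c *: u) = c *: lift0 u.
Proof. by have := lift0_linear c u 0; rewrite lift0_0 !addr0. Qed.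

Let lift0_null v : v \in tens_null -> lift0 v = 0.
Proof.
move=> /asboolP [r [rS ->]]; elim: r rS => [|e r IH] rS.
  by rewrite big_nil lift0_0.
rewrite big_cons lift0D lift0Z IH ?addr0; last first.
  by move=> c cr; apply: rS; rewrite inE cr orbT.
suff -> : lift0 e.2 = 0 by rewrite scaler0.
have /rS : e \in e :: r by rewrite mem_head.
have FDl x x' y : F (x + x') y = F x y + F x' y.
  by have := Fl y 1 x x'; rewrite !scale1r.
have FDr x y y' : F x (y + y') = F x y + F x y'.
  by have := Fr x 1 y y'; rewrite !scale1r.
have F0l y : F 0 y = 0.
  by apply: (addrI (F 0 y)); rewrite -FDl !addr0.
have F0r x : F x 0 = 0.
  by apply: (addrI (F x 0)); rewrite -FDr !addr0.
case=> [x x' y|x y y'|c x y|c x y|x b y]; rewrite lift0B ?lift0D ?lift0Z !lift0_gen; apply/eqP; rewrite subr_eq0.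
- by rewrite FDl.
- by rewrite FDr.
- by have := Fl y c x 0; rewrite F0l !addr0 => ->.
- by have := Fr x c y 0; rewrite F0r !addr0 => ->.
- by rewrite Fbal.
Qed.

Definition tens_lift (t : tensor) : W :=
  lift0 (repr (t : Quotient.quot tens_null)).

Let tens_lift_pi v : tens_lift (tens_pi v) = lift0 v.
Proof.
apply/eqP; rewrite -subr_eq0 -lift0B; apply/eqP/lift0_null.
by rewrite tens_piP /tens_pi reprK.
Qed.

Lemma tens_lift_linear : linear tens_lift.
Proof.
move=> c t u; case: (tens_pi_surj t) (tens_pi_surj u) => v -> [w ->].
by rewrite -tens_pi_linear !tens_lift_pi lift0_linear.
Qed.

Lemma tens_liftE x y : tens_lift (tens x y) = F x y.
Proof. by rewrite tens_lift_pi lift0_gen. Qed.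

End Lift.

(* The outer actions a (x (x) y) c = (a x) (x) (y c). *)
Definition tens_lact (a : A) : tensor -> tensor :=
  tens_lift (fun x y => tens (lact a x) y).
Definition tens_ract (t : tensor) (c : C) : tensor :=
  tens_lift (fun x y => tens x (ract y c)) t.

Let lactF (a : A) : [/\ forall y, linear (fun x => tens (lact a x) y),
  forall x, linear (tens (lact a x)) &
  forall x (b : B) y, tens (lact a (ract x b)) y = tens (lact a x) (lact b y)].
Proof.
split=> [y c x x'|x|x b y].
- by rewrite lact_linr tens_linl.
- exact: tens_linr.
- by rewrite -lractA tens_bal.
Qed.

Let ractF (c : C) : [/\ forall y, linear (fun x => tens x (ract y c)),
  forall x, linear (fun y => tens x (ract y c)) &
  forall x (b : B) y, tens (ract x b) (ract y c) = tens x (ract (lact b y) c)].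
Proof.
split=> [y|x d y y'|x b y].
- exact: tens_linl.
- by rewrite ract_linl tens_linr.
- by rewrite lractA tens_bal.
Qed.

Lemma tens_lactE a x y : tens_lact a (tens x y) = tens (lact a x) y.
Proof. by have [h1 h2 h3] := lactF a; rewrite /tens_lact tens_liftE. Qed.

Lemma tens_ractE x y c : tens_ract (tens x y) c = tens x (ract y c).
Proof. by have [h1 h2 h3] := ractF c; rewrite /tens_ract tens_liftE. Qed.

Fact tens_lact_linr a : linear (tens_lact a).
Proof. by have [h1 h2 h3] := lactF a; apply: tens_lift_linear. Qed.

Fact tens_ract_linl c : linear (fun t => tens_ract t c).
Proof. by have [h1 h2 h3] := ractF c; apply: tens_lift_linear. Qed.

Let linC (c : k) (u v : tensor -> tensor) : linear u -> linear v ->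
  linear (fun t => c *: u t + v t).
Proof.
move=> lu lv d t t'; rewrite lu lv !scalerDr !scalerA (mulrC c d).
by rewrite -!addrA; congr (_ + _); rewrite addrCA.
Qed.

Fact tens_lact_linl t : linear (fun a => tens_lact a t).
Proof.
move=> c a a'; move: t; apply: tens_linear_ext.
- exact: tens_lact_linr.
- by apply: linC; apply: tens_lact_linr.
- by move=> x y; rewrite !tens_lactE lact_linl tens_linl.
Qed.

Fact tens_ract_linr t : linear (tens_ract t).
Proof.
move=> d c c'; move: t; apply: tens_linear_ext.
- exact: tens_ract_linl.
- by apply: linC; apply: tens_ract_linl.
- by move=> x y; rewrite !tens_ractE ract_linr tens_linr.
Qed.

Fact tens_lactA (a a' : A) t :
  tens_lact (a * a')%g t = tens_lact a (tens_lact a' t).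
Proof.
move: t; apply: tens_linear_ext; first exact: tens_lact_linr.
  by move=> c t u; rewrite !tens_lact_linr.
by move=> x y; rewrite !tens_lactE lactA.
Qed.

Fact tens_ractA t (c c' : C) :
  tens_ract t (c * c')%g = tens_ract (tens_ract t c) c'.
Proof.
move: t; apply: tens_linear_ext; first exact: tens_ract_linl.
  by move=> d t u; rewrite !tens_ract_linl.
by move=> x y; rewrite !tens_ractE ractA.
Qed.

Fact tens_lractA a t c :
  tens_ract (tens_lact a t) c = tens_lact a (tens_ract t c).
Proof.
move: t; apply: tens_linear_ext.
- by move=> d t u; rewrite tens_lact_linr tens_ract_linl.
- by move=> d t u; rewrite tens_ract_linl tens_lact_linr.
- by move=> x y; rewrite tens_lactE !tens_ractE tens_lactE.
Qed.

HB.instance Definition _ := Lmodule_isBimodule.Build k A C tensor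
  tens_lact_linl tens_lact_linr tens_ract_linl tens_ract_linr
  tens_lactA tens_ractA tens_lractA.

End Tensor.

(* homog t is the component of degree t; homog_sum says that the module is
   the internal direct sum of its components. *)
HB.mixin Record Lmodule_isGraded (G : groupType) (k : comPzRingType) V
    of GRing.Lmodule k V := {
  homog : G -> {pred V};
  homog_submod : forall t, submod_closed (homog t);
  homog_sum : forall v : V, exists! f : dirsum G V,
    (forall t, f t \in homog t) /\ v = \sum_(t <- finsupp f) f t
}.

#[short(type="gradedModType")]
HB.structure Definition GradedModule (G : groupType) (k : comPzRingType) :=
  {V of GRing.Lmodule k V & Lmodule_isGraded G k V}.

HB.mixin Record NuAlgebra_isGraded (G : groupType) (k : comPzRingType) A
    of NuAlgebra k A & GradedModule G k A := {
  homogM : forall (s t : G) (a b : A),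
    a \in homog s -> b \in homog t -> (a * b)%g \in homog (s * t)%g
}.

#[short(type="gradedAlgType")]
HB.structure Definition GradedAlgebra (G : groupType) (k : comPzRingType) :=
  {A of NuAlgebra k A & GradedModule G k A & NuAlgebra_isGraded G k A}.

HB.mixin Record Bimodule_isGraded (G : groupType) (k : comPzRingType)
    (A B : gradedAlgType G k) X
    of Bimodule k A B X & GradedModule G k X := {
  homog_lact : forall (s t : G) (a : A) (x : X),
    a \in homog s -> x \in homog t -> lact a x \in homog (s * t)%g;
  homog_ract : forall (s t : G) (x : X) (b : B),
    x \in homog s -> b \in homog t -> ract x b \in homog (s * t)%g
}.

#[short(type="gradedBimodType")]
HB.structure Definition GradedBimodule (G : groupType) (k : comPzRingType)
    (A B : gradedAlgType G k) :=
  {X of Bimodule k A B X & GradedModule G k X & Bimodule_isGraded G k A B X}.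

Definition morita_context (k : comPzRingType) (A B : nuAlgType k)
    (X : bimodType A B) (Y : bimodType B A)
    (tauA : {linear tensor X Y -> A}) (tauB : {linear tensor Y X -> B}) : Prop :=
  [/\ (forall (a : A) t, tauA (lact a t) = (a * tauA t)%g) /\
      (forall t (a : A), tauA (ract t a) = (tauA t * a)%g),
      (forall (b : B) t, tauB (lact b t) = (b * tauB t)%g) /\
      (forall t (b : B), tauB (ract t b) = (tauB t * b)%g),
      forall (x x' : X) (y : Y),
        lact (tauA (tens x y)) x' = ract x (tauB (tens y x')) &
      forall (x : X) (y y' : Y),
        lact (tauB (tens y x)) y' = ract y (tauA (tens x y'))].

(* The k-span of the tensors x (x) y with x in U and y in V. *)
Definition tens_sub (k : comPzRingType) (A B C : nuAlgType k)
    (X : bimodType A B) (Y : bimodType B C) (U : {pred X}) (V : {pred Y}) :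
    tensor X Y -> Prop :=
  span (fun t => exists x y, [/\ x \in U, y \in V & t = tens x y]).

Definition graded_morita_context (G : groupType) (k : comPzRingType)
    (A B : gradedAlgType G k) (X : gradedBimodType A B) (Y : gradedBimodType B A)
    (tauA : {linear tensor X Y -> A}) (tauB : {linear tensor Y X -> B}) : Prop :=
  [/\ morita_context tauA tauB,
      forall (r s : G) t,
        tens_sub (homog r : {pred X}) (homog s : {pred Y}) t ->
        tauA t \in homog (r * s)%g &
      forall (r s : G) t,
        tens_sub (homog r : {pred Y}) (homog s : {pred X}) t ->
        tauB t \in homog (r * s)%g].

(* Graded equivalence is a relation between idempotent algebras only. *)
Definition graded_equivalent (G : groupType) (k : comPzRingType)
    (A B : gradedAlgType G k) : Prop :=
  [/\ idempotent_alg A, idempotent_alg B &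
   exists (X : gradedBimodType A B) (Y : gradedBimodType B A)
     (tauA : {linear tensor X Y -> A}) (tauB : {linear tensor Y X -> B}),
     [/\ graded_morita_context tauA tauB,
         unital_bimod X, unital_bimod Y,
         (forall a : A, exists t, tauA t = a) &
         (forall b : B, exists t, tauB t = b)]].

Record alg_action (G : groupType) (k : comPzRingType) (C : nuAlgType k) :=
  AlgAction {
    act_fun :> G -> C -> C;
    act_linear : forall t, linear (act_fun t);
    act_mul : forall t (c d : C),
      act_fun t (c * d)%g = (act_fun t c * act_fun t d)%g;
    act_id : forall c, act_fun 1%g c = c;
    act_comp : forall s t c, act_fun (s * t)%g c = act_fun s (act_fun t c)
  }.

(* ds1 t c stands for c delta_t. *)
Definition skew_alg (G : groupType) (k : comPzRingType) (C : nuAlgType k)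
    (th : alg_action G C) : Type := dirsum G C.

Section Skew.
Variables (G : groupType) (k : comPzRingType) (C : nuAlgType k).
Variable th : alg_action G C.

Local Notation skew_alg := (skew_alg th).

HB.instance Definition _ := GRing.Lmodule.on skew_alg.

(* (c delta_s) (d delta_t) = c th_s(d) delta_{st}, extended bilinearly. *)
Definition skew_mul : skew_alg -> skew_alg -> skew_alg :=
  ds_bil (fun s t (c d : C) => ds1 (s * t)%g (c * th s d)%g : skew_alg).

Let linl (s t : G) (d : C) :
  linear (fun c : C => ds1 (s * t)%g (c * th s d)%g : skew_alg).
Proof. by move=> a c c'; rewrite nu_linl ds1D ds1Z. Qed.

Let linr (s t : G) (c : C) :
  linear (fun d : C => ds1 (s * t)%g (c * th s d)%g : skew_alg).
Proof. by move=> a d d'; rewrite act_linear nu_linr ds1D ds1Z. Qed.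

Lemma skew_mul1 s t c d :
  skew_mul (ds1 s c) (ds1 t d) = ds1 (s * t)%g (c * th s d)%g.
Proof. exact: (ds_bil1 linl linr). Qed.

Fact skew_linl g : linear (fun f => skew_mul f g).
Proof. exact: (ds_bil_linl linl). Qed.

Fact skew_linr f : linear (skew_mul f).
Proof. exact: (ds_bil_linr linr). Qed.

Fact skew_mulA : associative skew_mul.
Proof.
move=> x y z; move: x.
apply: ds_linear_ext => [a x x'|a x x'|r b]; rewrite ?skew_linl //.
move: y; apply: ds_linear_ext => [a y y'|a y y'|s c].
- by rewrite skew_linl skew_linr.
- by rewrite skew_linr skew_linl.
move: z; apply: ds_linear_ext => [a z z'|a z z'|t d]; rewrite ?skew_linr //.
by rewrite !skew_mul1 act_mul act_comp !mulgA.
Qed.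

HB.instance Definition _ := isSemigroup.Build skew_alg skew_mulA.
HB.instance Definition _ :=
  Semigroup_isNuAlgebra.Build k skew_alg skew_linl skew_linr.

Definition skew_homog (t : G) : {pred skew_alg} :=
  [pred f : skew_alg | finsupp f `<=` [fset t]]%fset.

Let skew_homogP t (f : skew_alg) :
  reflect (forall s, s != t -> f s = 0) (f \in skew_homog t).
Proof.
apply: (iffP idP) => [/fsubsetP sf s st|f0].
  by apply: ds_out; apply: contra st => /sf; rewrite inE.
apply/fsubsetP => s; rewrite mem_finsupp inE; apply: contraNT => st.
by apply/eqP/f0.
Qed.

Fact skew_homog_submod t : submod_closed (skew_homog t).
Proof.
split=> [|a f g /skew_homogP f0 /skew_homogP g0]; apply/skew_homogP => s st.
  exact: ds0E.
by rewrite dsDE dsZE f0 // g0 // scaler0 addr0.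
Qed.

Fact skew_homog_sum (v : skew_alg) : exists! f : dirsum G skew_alg,
  (forall t, f t \in skew_homog t) /\ v = \sum_(t <- finsupp f) f t.
Proof.
pose F : dirsum G skew_alg := ds_mk (finsupp v) (fun t => ds1 t (v t) : skew_alg).
have FE t : F t = ds1 t (v t).
  by rewrite ds_mkE; case: ifPn => // /ds_out ->; rewrite ds10.
exists F; split.
  split=> [t|].
    by rewrite FE; apply/skew_homogP => s /negPf st; rewrite ds1E st.
  have sF : (finsupp F `<=` finsupp v)%fset.
    apply/fsubsetP => t; rewrite !mem_finsupp FE; apply: contra => /eqP ->.
    by rewrite ds10.
  rewrite {1}(ds_sum1 (fsubset_refl (finsupp v))).
  symmetry; under eq_bigr do rewrite FE.
  apply: big_fset_incl => // t tv; rewrite mem_finsupp negbK FE => /eqP.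
  by [].
move=> f [fh vE]; apply/dsP => t; rewrite FE; apply/dsP => s; rewrite ds1E.
have vs r : v r = f r r.
  rewrite vE ds_sumE; have [rf|rf] := boolP (r \in finsupp f).
    rewrite (big_fsetD1 r) //= big1_fset ?addr0 // => u.
    rewrite !inE => /andP [ur _] _.
    by have /skew_homogP -> := fh u; rewrite // eq_sym.
  rewrite (ds_out rf) ds0E big1_fset // => u uf _.
  have /skew_homogP -> // := fh u.
  by apply: contraNneq rf => ->.
case: eqP => [->|/eqP st]; first exact: vs.
by have /skew_homogP -> := fh t.
Qed.

HB.instance Definition _ :=
  Lmodule_isGraded.Build G k skew_alg skew_homog_submod skew_homog_sum.

Fact skew_homogM (s t : G) (a b : skew_alg) :
  a \in homog s -> b \in homog t -> (a * b)%g \in homog (s * t)%g.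
Proof.
have E u (f : skew_alg) : f \in skew_homog u -> f = ds1 u (f u).
  move=> /skew_homogP f0; apply/dsP => r; rewrite ds1E.
  by case: eqP => [->|/eqP /f0].
move=> /E -> /E ->.
rewrite [X in X \in _]skew_mul1; apply/skew_homogP => r /negPf rst.
by rewrite ds1E rst.
Qed.

HB.instance Definition _ := NuAlgebra_isGraded.Build G k skew_alg skew_homogM.

End Skew.

Section Matrices.
Variables (I : choiceType) (k : comPzRingType) (B : nuAlgType k).

(* I * I-matrices over B with finitely many nonzero entries; ds1 (r, s) b is
   the matrix b e_{r,s}. *)
Definition fmx := dirsum (I * I)%type B.

HB.instance Definition _ := GRing.Lmodule.on fmx.

(* (a e_{r,s}) (b e_{t,u}) = ab e_{r,u} if s = t and 0 otherwise, extended
   bilinearly; fmx_mulE gives the entries of a product. *)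
Let fmx_unit_mul (p q : I * I) (a b : B) : fmx :=
  if p.2 == q.1 then ds1 (p.1, q.2) (a * b)%g else 0.

Definition fmx_mul : fmx -> fmx -> fmx := ds_bil fmx_unit_mul.

Let linl p q b : linear (fun a => fmx_unit_mul p q a b).
Proof.
move=> c a a'; rewrite /fmx_unit_mul; case: eqP => _.
  by rewrite nu_linl ds1D ds1Z.
by rewrite scaler0 addr0.
Qed.

Let linr p q a : linear (fmx_unit_mul p q a).
Proof.
move=> c b b'; rewrite /fmx_unit_mul; case: eqP => _.
  by rewrite nu_linr ds1D ds1Z.
by rewrite scaler0 addr0.
Qed.

Lemma fmx_mul1 p q a b : fmx_mul (ds1 p a) (ds1 q b) =
  if p.2 == q.1 then ds1 (p.1, q.2) (a * b)%g else 0.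
Proof. exact: (ds_bil1 linl linr). Qed.

Fact fmx_linl g : linear (fun f => fmx_mul f g).
Proof. exact: (ds_bil_linl linl). Qed.

Fact fmx_linr f : linear (fmx_mul f).
Proof. exact: (ds_bil_linr linr). Qed.

Lemma fmx_mulE (f g : fmx) (S : {fset I}) :
  (forall r t, f (r, t) != 0 -> t \in S) ->
  forall r s, fmx_mul f g (r, s) = \sum_(t <- S) (f (r, t) * g (t, s))%g.
Proof.
move=> fS r s; have mul1E p a : fmx_mul (ds1 p a) g (r, s) =
    if p.1 == r then (a * g (p.2, s))%g else 0.
  move: g; apply: ds_linear_ext => [c g g'|c g g'|q b].
  - by rewrite fmx_linr dsDE dsZE.
  - by case: eqP => _; rewrite ?scaler0 ?addr0 // dsDE dsZE nu_linr.
  rewrite fmx_mul1 ds1E; case: q => t u /=.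
  have mulg0 (x : B) : (x * 0)%g = 0.
    by have := nu_linr x (-1) 0 0; rewrite !scaleN1r !addNr.
  rewrite xpair_eqE; case: (p.2 =P t) => pt.
    rewrite ds1E xpair_eqE [r == _]eq_sym.
    by case: eqP => // _; case: eqP.
  by rewrite ds0E; case: eqP.
have sumE (F : seq (I * I)) : fmx_mul (\sum_(p <- F) ds1 p (f p)) g (r, s)
    = \sum_(p <- F) fmx_mul (ds1 p (f p)) g (r, s).
  elim: F => [|p F IH].
    rewrite !big_nil.
    have -> : fmx_mul 0 g = 0.
      by have := fmx_linl g (-1) 0 0; rewrite !scaleN1r !addNr.
    exact: ds0E.
  rewrite !big_cons -IH -dsDE; congr (fun_of_fsfun _ _).
  by have := fmx_linl g 1 (ds1 p (f p)) (\sum_(p <- F) ds1 p (f p));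
    rewrite !scale1r.
rewrite {1}(ds_sum1 (fsubset_refl (finsupp f))) sumE.
under eq_bigr do rewrite mul1E.
have mul0g (x : B) : (0 * x)%g = 0.
  by have := nu_linl x (-1) 0 0; rewrite !scaleN1r !addNr.
transitivity (\sum_(p <- finsupp f) \sum_(t <- S)
    if p == (r, t) then (f p * g (t, s))%g else 0).
  apply: eq_big_seq => -[p1 p2]; rewrite mem_finsupp => pf.
  rewrite (big_fsetD1 p2) ?(fS _ _ pf) //= big1_fset ?addr0; last first.
    move=> t; rewrite !inE => /andP [tp _] _.
    by rewrite xpair_eqE [p2 == t]eq_sym (negPf tp) andbF.
  by rewrite xpair_eqE eqxx andbT.
rewrite exchange_big; apply: eq_bigr => t _.
have [rf|rf] := boolP ((r, t) \in finsupp f); last first.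
  rewrite (ds_out rf) mul0g big1_fset // => p pf _.
  by case: eqP => // pE; rewrite -pE pf in rf.
rewrite (big_fsetD1 (r, t)) //= eqxx big1_fset ?addr0 // => p.
by rewrite !inE => /andP [/negPf -> _].
Qed.

Let mul0 f : fmx_mul f 0 = 0.
Proof. by have := fmx_linr f (-1) 0 0; rewrite !scaleN1r !addNr. Qed.

Let mul0' f : fmx_mul 0 f = 0.
Proof. by have := fmx_linl f (-1) 0 0; rewrite !scaleN1r !addNr. Qed.

Fact fmx_mulA : associative fmx_mul.
Proof.
move=> x y z; move: x.
apply: ds_linear_ext => [a x x'|a x x'|p b]; rewrite ?fmx_linl //.
move: y; apply: ds_linear_ext => [a y y'|a y y'|q c].
- by rewrite fmx_linl fmx_linr.
- by rewrite fmx_linr fmx_linl.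
move: z; apply: ds_linear_ext => [a z z'|a z z'|r d]; rewrite ?fmx_linr //.
rewrite !fmx_mul1; case: eqP => qr; case: eqP => pq;
  by rewrite ?mul0 ?mul0' ?fmx_mul1 /= ?qr ?pq ?eqxx ?mulgA // ; case: eqP.
Qed.

HB.instance Definition _ := isSemigroup.Build fmx fmx_mulA.
HB.instance Definition _ := Semigroup_isNuAlgebra.Build k fmx fmx_linl fmx_linr.

End Matrices.

Section Smash.
Variables (G : groupType) (k : comPzRingType) (B : gradedAlgType G k).

Definition smash_pred : {pred fmx G B} :=
  [pred f : fmx G B |
     all (fun p : G * G => f p \in homog (p.1^-1 * p.2)%g) (finsupp f)].

Lemma smash_predP (f : fmx G B) :
  reflect (forall r s : G, f (r, s) \in homog (r^-1 * s)%g) (f \in smash_pred).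
Proof.
apply: (iffP allP) => [h r s|h [r s] _]; last exact: h.
have [/h //|/ds_out ->] := boolP ((r, s) \in finsupp f).
by case: (homog_submod (s := B) (r^-1 * s)%g).
Qed.

Fact smash_submod : submod_closed smash_pred.
Proof.
split=> [|a f g /smash_predP hf /smash_predP hg]; apply/smash_predP => r s;
  have [h0 hD] := homog_submod (s := B) (r^-1 * s)%g.
  by rewrite ds0E.
by rewrite dsDE dsZE hD.
Qed.

Fact smash_mulg_closed : mulg_closed smash_pred.
Proof.
move=> f g /smash_predP hf /smash_predP hg; apply/smash_predP => r s.
have [h0 hD] := homog_submod (s := B) (r^-1 * s)%g.
pose S := [fset p.2 | p in finsupp f]%fset.
rewrite [X in X \in _](@fmx_mulE _ _ _ f g S) => [|u t ft]; last first.
  by apply/imfsetP; exists (u, t); rewrite //= mem_finsupp.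
elim/big_rec: _ => // t x _ hx; rewrite -[(_ * _)%g]scale1r hD //.
have -> : (r^-1 * s = (r^-1 * t) * (t^-1 * s))%g by rewrite -mulgA mulVKg.
exact: homogM.
Qed.

HB.instance Definition _ := GRing.isSubmodClosed.Build k (fmx G B) smash_pred
  (GRing.submod_closed_semi smash_submod).

(* B # G, the matrices whose (r, s) entries have degree r^-1 s. *)
Record smash : Type := Smash {
  smash_val :> fmx G B;
  _ : smash_val \in smash_pred
}.

HB.instance Definition _ := [isSub for smash_val].
HB.instance Definition _ := [Choice of smash by <:].
HB.instance Definition _ := [SubChoice_isSubZmodule of smash by <:].
HB.instance Definition _ := [SubZmodule_isSubLmodule of smash by <:].
HB.instance Definition _ :=
  SubChoice_isSubSemigroup.Build (fmx G B) smash_pred smash smash_mulg_closed.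

Lemma smash_valP c (f g : smash) :
  smash_val (c *: f + g) = c *: smash_val f + smash_val g.
Proof. exact: (linearP (val : smash -> fmx G B)). Qed.

Lemma smash_valM (f g : smash) :
  smash_val (f * g)%g = (smash_val f * smash_val g)%g.
Proof. exact: (valM (f : smash) g). Qed.

Fact smash_linl (b : smash) : linear (fun a : smash => (a * b)%g).
Proof.
move=> c a a'; apply: val_inj.
by rewrite valM [X in (X * _)%g](smash_valP c a a') [RHS](smash_valP c) !valM;
  exact: nu_linl.
Qed.

Fact smash_linr (a : smash) : linear (fun b : smash => (a * b)%g).
Proof.
move=> c b b'; apply: val_inj.
by rewrite valM [X in (_ * X)%g](smash_valP c b b') [RHS](smash_valP c) !valM;
  exact: nu_linr.
Qed.

HB.instance Definition _ :=
  Semigroup_isNuAlgebra.Build k smash smash_linl smash_linr.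

(* The matrix action b e_{r,s} |-> b e_{tr,ts}, extended linearly. *)
Definition fmx_shift (t : G) : fmx G B -> fmx G B :=
  ds_lin (fun p (b : B) => ds1 (t * p.1, t * p.2)%g b : fmx G B).

Let shift_lin (t : G) (p : G * G) :
  linear (fun b : B => ds1 (t * p.1, t * p.2)%g b : fmx G B).
Proof. by move=> c b b'; rewrite ds1D ds1Z. Qed.

Fact fmx_shift_linear t : linear (fmx_shift t).
Proof. exact: ds_lin_is_linear (shift_lin t). Qed.

Lemma fmx_shift1 t p b : fmx_shift t (ds1 p b) = ds1 (t * p.1, t * p.2)%g b.
Proof. exact: ds_lin1 (shift_lin t) _ _. Qed.

Lemma fmx_shiftE t f r s : fmx_shift t f (r, s) = f (t^-1 * r, t^-1 * s)%g.
Proof.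
move: f; apply: ds_linear_ext => [c f g|c f g|[u v] b].
- by rewrite fmx_shift_linear dsDE dsZE.
- by rewrite dsDE dsZE.
rewrite fmx_shift1 !ds1E !xpair_eqE /=; congr (if _ && _ then _ else _).
  by apply/eqP/eqP => [->|<-]; rewrite ?mulKg ?mulVKg.
by apply/eqP/eqP => [->|<-]; rewrite ?mulKg ?mulVKg.
Qed.

Fact fmx_shift_smash t (f : smash) : fmx_shift t f \in smash_pred.
Proof.
case: f => f /= /smash_predP hf; apply/smash_predP => r s.
rewrite fmx_shiftE; have := hf (t^-1 * r)%g (t^-1 * s)%g.
by rewrite invgM invgK -mulgA mulVKg.
Qed.

Definition smash_shift (t : G) (f : smash) : smash :=
  Smash (fmx_shift_smash t f).

Fact smash_shift_linear t : linear (smash_shift t).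
Proof.
move=> c f g; apply: val_inj; rewrite [RHS](smash_valP c) /=.
rewrite [X in fmx_shift t X](smash_valP c f g); exact: fmx_shift_linear.
Qed.

Fact smash_shift_mul t (f g : smash) :
  smash_shift t (f * g)%g = (smash_shift t f * smash_shift t g)%g.
Proof.
apply: val_inj; rewrite [RHS]smash_valM /= [X in fmx_shift t X]smash_valM.
move: (smash_val f) (smash_val g) => {g}f g.
have shL := fmx_shift_linear t.
have mL := @fmx_linl G k B; have mR := @fmx_linr G k B.
move: f; apply: ds_linear_ext => [c f f'|c f f'|p a].
- by rewrite [(_ * g)%g]mL shL.
- by rewrite shL [LHS]mL.
move: g; apply: ds_linear_ext => [c g g'|c g g'|q b].
- by rewrite [(_ * (c *: _ + _))%g]mR shL.
- by rewrite shL [LHS]mR.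
rewrite !fmx_shift1 [X in fmx_shift t X]fmx_mul1 [RHS]fmx_mul1 /=.
rewrite (inj_eq (mulgI t)); case: eqP => _; first by rewrite fmx_shift1.
by have := shL (-1) 0 0; rewrite !scaleN1r !addNr.
Qed.

Fact smash_shift_id f : smash_shift 1%g f = f.
Proof.
apply: val_inj; apply/dsP => -[r s] /=.
by rewrite fmx_shiftE invg1 !mul1g.
Qed.

Fact smash_shift_comp s t f :
  smash_shift (s * t)%g f = smash_shift s (smash_shift t f).
Proof.
apply: val_inj; apply/dsP => -[u v] /=.
by rewrite !fmx_shiftE invgM !mulgA.
Qed.

Definition smash_action : alg_action G smash :=
  AlgAction smash_shift_linear smash_shift_mul smash_shift_id smash_shift_comp.

End Smash.

(* Main.v *)
From HB Require Import structures.
From mathcomp Require Import all_boot all_order all_algebra finmap boolp.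
Require Import Defs.

(** Both algebras are graded matrix algebras over B.  For a map w : I -> G, let
    M_I(B) be the algebra of I x I matrices over B with finitely many nonzero
    entries, where a matrix has degree t if its (i, j) entry always has degree
    (w i)^-1 t (w j).  Then B is M_I(B) for I a point and w = 1, and, less
    obviously, (B # G) x| G is M_G(B) for w = id, by

      b e_{r,s} delta_t |-> b E_{r, t^-1 s}

    (skew_mx).  It is multiplicative because the shift by s that twists the
    product of the skew group algebra is undone by the factor s^-1 in the column
    index (col_shift_mul).  It is injective because the terms that land in the
    same entry (r, q), one for each t, have the pairwise different degrees
    r^-1 t q in B (skew_mx_inj).  It is onto because an entry b of degree d at
    (r, q) comes from t = r d q^-1 (skew_mx_surj, one degree t at a time).

    Whenever A and A' are such matrix algebras M_I(B) and M_J(B), the I x J and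
    the J x I matrices over B, graded by the same formula, are bimodules over
    them, and the two matrix products are the pairings of a graded Morita context
    (mx_models_equivalent): all its axioms are the associativity of the product
    of rectangular matrices.  If B is idempotent then a matrix unit with entry b
    is a sum of matrix units with entries b' b'', and
    b' b'' E_{i,j} = (b' E_{i,l}) (b'' E_{l,j}) for any l.  This single formula
    shows that the algebras are idempotent, that the bimodules are unital and that
    the pairings are onto. *)

Set Implicit Arguments.
Unset Strict Implicit.
Unset Printing Implicit Defensive.

Import GRing.Theory.
Local Open Scope ring_scope.

(** * Linear functions and direct sums *)

(** The structures below come with plain functions and proofs of linear f; these
    are the consequences of such a proof. *)
Section LinearFunctions.
Variables (k : pzRingType) (V W : lmodType k) (f : V -> W).
Hypothesis lf : linear f.

Lemma linD u v : f (u + v) = f u + f v.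
Proof. by have := lf 1 u v; rewrite !scale1r. Qed.

Lemma lin0 : f 0 = 0.
Proof. by apply: (addrI (f 0)); rewrite -linD !addr0. Qed.

Lemma linZ c u : f (c *: u) = c *: f u.
Proof. by have := lf c u 0; rewrite lin0 !addr0. Qed.

Lemma linB u v : f (u - v) = f u - f v.
Proof. by rewrite linD -scaleN1r linZ scaleN1r. Qed.

Lemma lin_sum T (r : seq T) (P : pred T) (F : T -> V) :
  f (\sum_(t <- r | P t) F t) = \sum_(t <- r | P t) f (F t).
Proof. exact: (big_morph f linD lin0). Qed.

End LinearFunctions.

Section DirectSums.
Variables (k : comPzRingType) (I : choiceType) (V : lmodType k).

Definition ds_total : dirsum I V -> V := ds_lin (fun _ v => v).

Lemma ds_total_linear : linear ds_total.
Proof. exact: ds_lin_is_linear. Qed.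

Lemma ds_total1 i v : ds_total (ds1 i v) = v.
Proof. exact: ds_lin1. Qed.

Lemma ds1_linear (i : I) : linear (fun v : V => ds1 i v).
Proof. by move=> c u v; rewrite ds1D ds1Z. Qed.

Lemma ds_ind (P : dirsum I V -> Prop) : P 0 ->
  (forall f g, P f -> P g -> P (f + g)) -> (forall i v, P (ds1 i v)) ->
  forall f, P f.
Proof.
move=> P0 PD P1 f; rewrite (ds_sum1 (fsubset_refl (finsupp f))).
by elim/big_rec: _ => [|i x _ Px] //; apply: PD.
Qed.

End DirectSums.

(** * Homogeneous components *)

Section Homogeneous.
Variables (G : groupType) (k : comPzRingType) (V : gradedModType G k).

Lemma homog0 t : (0 : V) \in homog t.
Proof. by case: (homog_submod (s := V) t). Qed.

Lemma homogZD t c (u v : V) :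
  u \in homog t -> v \in homog t -> c *: u + v \in homog t.
Proof. by case: (homog_submod (s := V) t) => _; apply. Qed.

Lemma homogD t (u v : V) : u \in homog t -> v \in homog t -> u + v \in homog t.
Proof. by move=> hu hv; rewrite -[u]scale1r homogZD. Qed.

Lemma homog_big t T (r : seq T) (P : pred T) (F : T -> V) :
  (forall x, P x -> F x \in homog t) -> \sum_(x <- r | P x) F x \in homog t.
Proof.
move=> FP; elim/big_rec: _ => [|x v Px hv]; first exact: homog0.
by rewrite homogD ?FP.
Qed.

Lemma homog_ind (P : V -> Prop) : P 0 ->
  (forall u v, P u -> P v -> P (u + v)) ->
  (forall t v, v \in homog t -> P v) -> forall v, P v.
Proof.
move=> P0 PD Ph v; have [f [[fh ->] _]] := homog_sum (s := V) v.
by elim/big_rec: _ => [|t x _ Px] //; apply: PD => //; apply: Ph (fh t).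
Qed.

(** Uniqueness of the decomposition of 0.  The degrees are given by an injective d,
    because the components that arise as entries of matrices are indexed by t but
    have degrees such as r^-1 t q. *)
Lemma homog_indep (T : eqType) (S : seq T) (d : T -> G) (h : T -> V) :
  uniq S -> injective d -> (forall t, h t \in homog (d t)) ->
  \sum_(t <- S) h t = 0 -> forall t, t \in S -> h t = 0.
Proof.
move=> uS dinj hh h0; pose f : dirsum G V := \sum_(t <- S) ds1 (d t) (h t).
have tf : ds_total f = 0.
  rewrite (lin_sum (@ds_total_linear _ _ _)) -[RHS]h0.
  by apply: eq_bigr => t _; rewrite ds_total1.
have f0 : f = 0.
  have [g [_ gu]] := homog_sum (s := V) (0 : V).
  rewrite -[RHS]gu.
    symmetry; apply: gu; split=> [u|]; last exact: esym.
    rewrite ds_sumE homog_big // => t _; rewrite ds1E.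
    by case: eqP => [->|_]; rewrite ?homog0.
  split=> [u|]; first by rewrite ds0E homog0.
  by rewrite -[RHS]/(ds_total _) (lin0 (@ds_total_linear _ _ _)).
move=> t tS; have := congr1 (fun e : dirsum G V => e (d t)) f0.
rewrite ds0E ds_sumE (bigD1_seq t) //= ds1E eqxx big1 ?addr0 // => u /negPf ut.
by rewrite ds1E (inj_eq dinj) eq_sym ut.
Qed.

End Homogeneous.

(** The components form a direct sum as soon as they span and a vanishing sum of
    homogeneous elements is trivial: apply the latter to the difference of two
    decompositions. *)
Lemma unique_decomposition (G : groupType) (k : comPzRingType) (V : lmodType k)
    (hom : G -> {pred V}) : (forall t, submod_closed (hom t)) ->
  (forall v, exists2 f : dirsum G V, forall t, f t \in hom t & v = ds_total f) ->
  (forall f : dirsum G V, (forall t, f t \in hom t) -> ds_total f = 0 -> f = 0) ->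
  forall v, exists! f : dirsum G V,
    (forall t, f t \in hom t) /\ v = \sum_(t <- finsupp f) f t.
Proof.
move=> hsub hex hindep v; have [f fh vE] := hex v.
exists f; split=> // g [gh]; rewrite -[X in _ = X]/(ds_total g) vE => fg.
apply/eqP; rewrite -subr_eq0; apply/eqP/hindep => [t|].
  rewrite dsDE dsNE addrC -scaleN1r; case: (hsub t) => _; exact.
by rewrite (linB (@ds_total_linear _ _ _)) fg subrr.
Qed.

(** * Products of rectangular matrices *)

Section MatrixProduct.
Variables (k : comPzRingType) (B : nuAlgType k).

Section Def.
Variables (I J K : choiceType).

Let unit_mul (p : I * J) (q : J * K) (a b : B) : dirsum (I * K)%type B :=
  if p.2 == q.1 then ds1 (p.1, q.2) (a * b)%g else 0.

Definition mxprod : dirsum (I * J)%type B -> dirsum (J * K)%type B ->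
  dirsum (I * K)%type B := ds_bil unit_mul.

Let linl p q b : linear (fun a => unit_mul p q a b).
Proof.
move=> c a a'; rewrite /unit_mul; case: eqP => _.
  by rewrite nu_linl ds1D ds1Z.
by rewrite scaler0 addr0.
Qed.

Let linr p q a : linear (unit_mul p q a).
Proof.
move=> c b b'; rewrite /unit_mul; case: eqP => _.
  by rewrite nu_linr ds1D ds1Z.
by rewrite scaler0 addr0.
Qed.

Lemma mxprod1 p q a b : mxprod (ds1 p a) (ds1 q b) =
  if p.2 == q.1 then ds1 (p.1, q.2) (a * b)%g else 0.
Proof. exact: (ds_bil1 linl linr). Qed.

Lemma mxprod_linl N : linear (fun M => mxprod M N).
Proof. exact: (ds_bil_linl linl). Qed.

Lemma mxprod_linr M : linear (mxprod M).
Proof. exact: (ds_bil_linr linr). Qed.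

End Def.

Lemma mxprodA (I J K L : choiceType) (M : dirsum (I * J)%type B)
    (N : dirsum (J * K)%type B) (O : dirsum (K * L)%type B) :
  mxprod M (mxprod N O) = mxprod (mxprod M N) O.
Proof.
move: M; apply: ds_linear_ext => [c M M'|c M M'|p b]; rewrite ?mxprod_linl //.
move: N; apply: ds_linear_ext => [c N N'|c N N'|q b'].
- by rewrite mxprod_linl mxprod_linr.
- by rewrite mxprod_linr mxprod_linl.
move: O; apply: ds_linear_ext => [c O O'|c O O'|r b'']; rewrite ?mxprod_linr //.
rewrite !mxprod1; case: (q.2 =P r.1) => qr; case: (p.2 =P q.1) => pq;
  rewrite ?(lin0 (mxprod_linr _)) ?(lin0 (mxprod_linl _)) ?mxprod1 //= ?qr ?pq
    ?eqxx ?mulgA //; by case: eqP.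
Qed.

End MatrixProduct.

(** * The grading of rectangular matrices *)

Section WeightedMatrices.
Variables (G : groupType) (k : comPzRingType) (B : gradedAlgType G k).

Section Grading.
Variables (I J : choiceType) (w : I -> G) (w' : J -> G).
Implicit Types M N : dirsum (I * J)%type B.

(** The exponents are such that the weights of the inner index cancel in a product
    of matrices, so that degrees multiply (mxprod_homog). *)
Definition mx_homog (t : G) : {pred dirsum (I * J)%type B} :=
  fun M => `[< forall i j, M (i, j) \in homog ((w i)^-1 * t * w' j)%g >].

Lemma mx_homogP t M :
  reflect (forall i j, M (i, j) \in homog ((w i)^-1 * t * w' j)%g)
          (M \in mx_homog t).
Proof. exact: asboolP. Qed.

Lemma mx_homog_submod t : submod_closed (mx_homog t).
Proof.
split=> [|c M N /mx_homogP hM /mx_homogP hN]; apply/mx_homogP => i j.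
  by rewrite ds0E homog0.
by rewrite dsDE dsZE homogZD.
Qed.

Lemma mx_homog1 t i j b : b \in homog ((w i)^-1 * t * w' j)%g ->
  ds1 (i, j) b \in mx_homog t.
Proof.
move=> hb; apply/mx_homogP => i' j'; rewrite ds1E xpair_eqE.
by case: eqP => [->|_]; case: eqP => [->|_]; rewrite ?homog0.
Qed.

(** Every matrix unit with a homogeneous entry b is homogeneous: if b has degree d
    then b E_{i,j} has degree (w i) d (w' j)^-1. *)
Lemma mx_homog_ind (P : dirsum (I * J)%type B -> Prop) : P 0 ->
  (forall M N, P M -> P N -> P (M + N)) ->
  (forall t i j b, ds1 (i, j) b \in mx_homog t -> P (ds1 (i, j) b)) ->
  forall M, P M.
Proof.
move=> P0 PD Ph; apply: ds_ind => // -[i j].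
apply: (@homog_ind G) => [|b b' Pb Pb'|t b hb]; first by rewrite ds10.
  by rewrite ds1D; apply: PD.
apply: (Ph (w i * t * (w' j)^-1)%g); apply: mx_homog1.
by rewrite !mulgA mulVg mul1g mulgVK.
Qed.

Lemma mx_homog_sum M : exists! f : dirsum G (dirsum (I * J)%type B),
  (forall t, f t \in mx_homog t) /\ M = \sum_(t <- finsupp f) f t.
Proof.
move: M; apply: unique_decomposition; first exact: mx_homog_submod.
  apply: mx_homog_ind => [|M N [f fh ->] [g gh ->]|t i j b hb].
  - exists 0 => [t|]; last by rewrite (lin0 (@ds_total_linear _ _ _)).
    by rewrite ds0E; case: (mx_homog_submod t).
  - exists (f + g) => [t|]; last by rewrite (linD (@ds_total_linear _ _ _)).
    rewrite dsDE -[f t]scale1r; case: (mx_homog_submod t) => _; exact.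
  - exists (ds1 t (ds1 (i, j) b)) => [u|]; last by rewrite ds_total1.
    by rewrite ds1E; case: eqP => [->|_] //; case: (mx_homog_submod u).
move=> f fh f0; apply/dsP => t; rewrite ds0E; apply/dsP => -[i j]; rewrite ds0E.
have [tf|/ds_out ->] := boolP (t \in finsupp f); last exact: ds0E.
apply: (@homog_indep G _ _ _ (finsupp f) (fun t => (w i)^-1 * t * w' j)%g
  (fun t => f t (i, j))) tf => //.
- by move=> x y /mulIg/mulgI.
- by move=> u; have /mx_homogP := fh u; exact.
- have := congr1 (fun M : dirsum _ B => M (i, j)) f0.
  by rewrite /ds_total /ds_lin ds_sumE ds0E.
Qed.

End Grading.

Lemma mxprod_homog (I J K : choiceType) (w : I -> G) (w' : J -> G) (w'' : K -> G)
    s t (M : dirsum (I * J)%type B) (N : dirsum (J * K)%type B) :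
  M \in mx_homog w w' s -> N \in mx_homog w' w'' t ->
  mxprod M N \in mx_homog w w'' (s * t)%g.
Proof.
move=> /mx_homogP hM /mx_homogP hN; have [h0 hD] := mx_homog_submod w w'' (s * t).
rewrite (ds_sum1 (fsubset_refl (finsupp M))) (lin_sum (mxprod_linl _)).
elim/big_rec: _ => // -[i j] x _ hx; rewrite -[mxprod _ _]scale1r hD // {x hx}.
rewrite (ds_sum1 (fsubset_refl (finsupp N))) (lin_sum (mxprod_linr _)).
elim/big_rec: _ => // -[j' l] x _ hx; rewrite -[mxprod _ _]scale1r hD // {x hx}.
rewrite mxprod1 /=; case: eqP => // jj; subst j'; apply: mx_homog1.
have -> : ((w i)^-1 * (s * t) * w'' l =
    ((w i)^-1 * s * w' j) * ((w' j)^-1 * t * w'' l))%g.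
  by rewrite !mulgA mulgK.
exact: homogM.
Qed.

(** This is the only way in which the idempotence of B enters: a linear property
    of matrices has to be checked on units whose entry is a product. *)
Lemma idempotent_mx_ind (I : choiceType) (P : dirsum I B -> Prop) :
  idempotent_alg B -> P 0 -> (forall u v, P u -> P v -> P (u + v)) ->
  (forall c u, P u -> P (c *: u)) -> (forall i b b', P (ds1 i (b * b')%g)) ->
  forall u, P u.
Proof.
move=> hB P0 PD PZ P1; apply: ds_ind => // i b.
have [r [rP ->]] := hB b; rewrite (lin_sum (@ds1_linear _ _ _ i)) big_seq.
elim/big_rec: _ => // c x cr Px; apply: PD => //.
by have [y [z ->]] := rP c cr; rewrite ds1Z; apply: PZ.
Qed.

(** * Algebras that are graded matrix algebras *)

(** A graded isomorphism of A with the I x I matrices over B.  Injectivity is asked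
    for at 0 and surjectivity in each degree, which is what one can verify
    directly; the inverse model_inv is recovered from these. *)
Record mx_model (A : gradedAlgType G k) (I : choiceType) (w : I -> G) := MxModel {
  model_fun :> A -> dirsum (I * I)%type B;
  model_linear : linear model_fun;
  model_mul : forall a b, model_fun (a * b)%g = mxprod (model_fun a) (model_fun b);
  model_inj : forall a, model_fun a = 0 -> a = 0;
  model_homog : forall t a, a \in homog t -> model_fun a \in mx_homog w w t;
  model_surj : forall t M, M \in mx_homog w w t ->
    exists2 a, a \in homog t & model_fun a = M
}.

Section Inverse.
Variables (A : gradedAlgType G k) (I : choiceType) (w : I -> G).
Variable alpha : mx_model A w.

Lemma model_onto M : exists a, alpha a = M.
Proof.
have lin := model_linear alpha.
move: M; apply: (@mx_homog_ind _ _ w w) => [|M N [a <-] [b <-]|t i j b hb].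
- by exists 0; rewrite (lin0 lin).
- by exists (a + b); rewrite (linD lin).
- by have [a _ <-] := model_surj alpha hb; exists a.
Qed.

Definition model_inv M : A := projT1 (cid (model_onto M)).

Lemma model_invK M : alpha (model_inv M) = M.
Proof. exact: projT2 (cid (model_onto M)). Qed.

Lemma model_injective : injective alpha.
Proof.
move=> a b ab; apply/eqP; rewrite -subr_eq0; apply/eqP; apply: (@model_inj _ _ _ alpha).
by rewrite (linB (model_linear alpha)) ab subrr.
Qed.

Lemma model_funK a : model_inv (alpha a) = a.
Proof. by apply: model_injective; rewrite model_invK. Qed.

Lemma model_inv_linear : linear model_inv.
Proof.
by move=> c M N; apply: model_injective; rewrite model_linear !model_invK.
Qed.

Lemma model_inv_mul M N : model_inv (mxprod M N) = (model_inv M * model_inv N)%g.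
Proof. by apply: model_injective; rewrite model_mul !model_invK. Qed.

Lemma model_inv_homog t M : M \in mx_homog w w t -> model_inv M \in homog t.
Proof. by move=> /(model_surj alpha) [a ha <-]; rewrite model_funK. Qed.

(** b b' E_{i,j} = (b E_{i,j}) (b' E_{j,j}). *)
Lemma model_idempotent : idempotent_alg B -> idempotent_alg A.
Proof.
move=> hB a; rewrite -[a]model_funK; move: (alpha a) => {a}.
apply: (idempotent_mx_ind hB) => [|M N|c M|[i j] b b'].
- by rewrite (lin0 model_inv_linear); apply: span0.
- by rewrite (linD model_inv_linear); apply: spanD.
- by rewrite (linZ model_inv_linear); apply: spanZ.
apply: span_gen; exists (model_inv (ds1 (i, j) b)), (model_inv (ds1 (j, j) b')).
by rewrite -model_inv_mul mxprod1 eqxx.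
Qed.

End Inverse.

(** * The Morita context of two matrix algebras *)

Section Bimodule.
Variables (A A' : gradedAlgType G k) (I J : choiceType) (w : I -> G) (w' : J -> G).

(** The models occur only as labels of the type: they determine how A and A' act on
    the matrices. *)
Definition model_bimod (alpha : mx_model A w) (alpha' : mx_model A' w') : Type :=
  dirsum (I * J)%type B.

Variables (alpha : mx_model A w) (alpha' : mx_model A' w').
Local Notation X := (model_bimod alpha alpha').

HB.instance Definition _ := GRing.Lmodule.on X.

Let lact0 (a : A) (x : X) : X := mxprod (alpha a) x.
Let ract0 (x : X) (a : A') : X := mxprod x (alpha' a).

Fact model_lact_linl x : linear (fun a => lact0 a x).
Proof. by move=> c a b; rewrite /lact0 model_linear mxprod_linl. Qed.
Fact model_lact_linr a : linear (lact0 a).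
Proof. exact: mxprod_linr. Qed.
Fact model_ract_linl a : linear (fun x => ract0 x a).
Proof. exact: mxprod_linl. Qed.
Fact model_ract_linr x : linear (ract0 x).
Proof. by move=> c a b; rewrite /ract0 model_linear mxprod_linr. Qed.
Fact model_lactA a b x : lact0 (a * b)%g x = lact0 a (lact0 b x).
Proof. by rewrite /lact0 model_mul mxprodA. Qed.
Fact model_ractA x a b : ract0 x (a * b)%g = ract0 (ract0 x a) b.
Proof. by rewrite /ract0 model_mul mxprodA. Qed.
Fact model_lractA a x b : ract0 (lact0 a x) b = lact0 a (ract0 x b).
Proof. by rewrite /ract0 /lact0 mxprodA. Qed.

HB.instance Definition _ := Lmodule_isBimodule.Build k A A' X
  model_lact_linl model_lact_linr model_ract_linl model_ract_linr
  model_lactA model_ractA model_lractA.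

HB.instance Definition _ := Lmodule_isGraded.Build G k X
  (mx_homog_submod w w') (mx_homog_sum w w').

Fact model_homog_lact s t (a : A) (x : X) :
  a \in homog s -> x \in homog t -> lact a x \in homog (s * t)%g.
Proof. by move=> /(model_homog alpha) ha hx; apply: mxprod_homog ha hx. Qed.

Fact model_homog_ract s t (x : X) (a : A') :
  x \in homog s -> a \in homog t -> ract x a \in homog (s * t)%g.
Proof. by move=> hx /(model_homog alpha') ha; apply: mxprod_homog hx ha. Qed.

HB.instance Definition _ := Bimodule_isGraded.Build G k A A' X
  model_homog_lact model_homog_ract.

Lemma model_lactE (a : A) (x : X) : lact a x = mxprod (alpha a) x.
Proof. by []. Qed.

Lemma model_ractE (x : X) (a : A') : ract x a = mxprod x (alpha' a).
Proof. by []. Qed.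

(** b b' E_{i,j} = (b E_{i,i}) (b' E_{i,j}) = (b E_{i,j}) (b' E_{j,j}). *)
Lemma model_unital : idempotent_alg B -> unital_bimod X.
Proof.
move=> hB; split; apply: (idempotent_mx_ind hB) => [|M N|c M|[i j] b b'];
  try exact: span0; try exact: spanD; try exact: spanZ; apply: span_gen.
- exists (model_inv alpha (ds1 (i, i) b)), (ds1 (i, j) b' : X).
  by rewrite model_lactE model_invK mxprod1 eqxx.
- exists (ds1 (i, j) b : X), (model_inv alpha' (ds1 (j, j) b')).
  by rewrite model_ractE model_invK mxprod1 eqxx.
Qed.

End Bimodule.

(** The product of an I x J matrix with a J x I matrix, carried back to A.
    Exchanging the two models gives the other pairing of the Morita context, so
    each property is proved once. *)
Section Pairing.
Variables (A A' : gradedAlgType G k) (I J : choiceType) (w : I -> G) (w' : J -> G).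
Variables (alpha : mx_model A w) (alpha' : mx_model A' w').
Local Notation X := (model_bimod alpha alpha').
Local Notation Y := (model_bimod alpha' alpha).

Let pairing0 (x : X) (y : Y) : A := model_inv alpha (mxprod x y).

Let pairing0_linl y : linear (fun x => pairing0 x y).
Proof. by move=> c x x'; rewrite /pairing0 mxprod_linl model_inv_linear. Qed.

Let pairing0_linr x : linear (pairing0 x).
Proof. by move=> c y y'; rewrite /pairing0 mxprod_linr model_inv_linear. Qed.

Let pairing0_bal x (a : A') y : pairing0 (ract x a) y = pairing0 x (lact a y).
Proof. by rewrite /pairing0 model_ractE model_lactE mxprodA. Qed.

Definition pairing_fun : tensor X Y -> A := tens_lift pairing0.

Fact pairing_linear : linear pairing_fun.
Proof. exact: tens_lift_linear. Qed.

HB.instance Definition _ :=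
  GRing.isLinear.Build k (tensor X Y) A _ pairing_fun pairing_linear.

Definition pairing : {linear tensor X Y -> A} := pairing_fun.

Lemma pairingE x y : pairing (tens x y) = model_inv alpha (mxprod x y).
Proof. exact: tens_liftE. Qed.

Lemma pairing_lact (a : A) t : pairing (lact a t) = (a * pairing t)%g.
Proof.
move: t; apply: tens_linear_ext => [c t u|c t u|x y].
- by rewrite lact_linr linearP.
- by rewrite linearP nu_linr.
rewrite [lact a _]tens_lactE !pairingE model_lactE -mxprodA model_inv_mul.
by rewrite model_funK.
Qed.

Lemma pairing_ract t (a : A) : pairing (ract t a) = (pairing t * a)%g.
Proof.
move: t; apply: tens_linear_ext => [c t u|c t u|x y].
- by rewrite ract_linl linearP.
- by rewrite linearP nu_linl.
rewrite [ract _ a]tens_ractE !pairingE model_ractE mxprodA model_inv_mul.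
by rewrite model_funK.
Qed.

Lemma pairing_homog r s t : tens_sub (homog r : {pred X}) (homog s : {pred Y}) t ->
  pairing t \in homog (r * s)%g.
Proof.
move=> [l [lP ->]]; rewrite linear_sum big_seq homog_big // => c cl.
rewrite linearZ -[X in X \in _]addr0 homogZD ?homog0 //.
have [x [y [hx hy ->]]] := lP c cl; rewrite pairingE.
by apply: model_inv_homog; apply: mxprod_homog hx hy.
Qed.

(** b b' E_{i,j} = (b E_{i,j0}) (b' E_{j0,j}): the inner index set must not be
    empty. *)
Lemma pairing_surj (j0 : J) : idempotent_alg B -> forall a, exists t, pairing t = a.
Proof.
move=> hB a; rewrite -[a](model_funK alpha); move: (alpha a) => {a}.
have lin := model_inv_linear alpha.
apply: (idempotent_mx_ind hB) => [|M N [t tE] [u uE]|c M [t tE]|[i j] b b'].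
- by exists 0; rewrite linear0 (lin0 lin).
- by exists (t + u); rewrite linearD tE uE (linD lin).
- by exists (c *: t); rewrite linearZ tE (linZ lin).
exists (tens (ds1 (i, j0) b : X) (ds1 (j0, j) b' : Y)).
by rewrite pairingE mxprod1 eqxx.
Qed.

End Pairing.

(** Both sides are the triple product x y x'. *)
Lemma pairing_compat (A A' : gradedAlgType G k) (I J : choiceType) (w : I -> G)
    (w' : J -> G) (alpha : mx_model A w) (alpha' : mx_model A' w')
    (x x' : model_bimod alpha alpha') (y : model_bimod alpha' alpha) :
  lact (pairing _ _ (tens x y)) x' = ract x (pairing _ _ (tens y x')).
Proof.
by rewrite !pairingE model_lactE model_ractE !model_invK mxprodA.
Qed.

Theorem mx_models_equivalent (A A' : gradedAlgType G k) (I J : choiceType)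
    (w : I -> G) (w' : J -> G) (alpha : mx_model A w) (alpha' : mx_model A' w') :
  I -> J -> idempotent_alg B -> graded_equivalent A A'.
Proof.
move=> i0 j0 hB; split; [exact: model_idempotent alpha hB| |].
  exact: model_idempotent alpha' hB.
exists (model_bimod alpha alpha'), (model_bimod alpha' alpha).
exists (pairing alpha alpha'), (pairing alpha' alpha); split.
- split; [|exact: pairing_homog|exact: pairing_homog].
  split=> [||x x' y|x y y'].
  + by split=> *; rewrite ?pairing_lact ?pairing_ract.
  + by split=> *; rewrite ?pairing_lact ?pairing_ract.
  + exact: pairing_compat.
  + exact: pairing_compat.
- exact: model_unital.
- exact: model_unital.
- exact: pairing_surj.
- exact: pairing_surj.
Qed.

(** * The algebra itself as a matrix algebra *)

Section Trivial.

Let w (u : unit) : G := 1%g.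

Let scalar (b : B) : dirsum (unit * unit)%type B := ds1 (tt, tt) b.

Let scalar_mul a b : scalar (a * b)%g = mxprod (scalar a) (scalar b).
Proof. by rewrite mxprod1. Qed.

Let scalar_inj b : scalar b = 0 -> b = 0.
Proof.
by move=> /(congr1 (fun M : dirsum _ _ => M (tt, tt))); rewrite ds1E ds0E.
Qed.

Let wE t : ((w tt)^-1 * t * w tt)%g = t.
Proof. by rewrite /w invg1 mul1g mulg1. Qed.

Let scalar_homog t b : b \in homog t -> scalar b \in mx_homog w w t.
Proof. by move=> hb; apply: mx_homog1; rewrite wE. Qed.

Let scalar_surj t M : M \in mx_homog w w t ->
  exists2 b, b \in homog t & scalar b = M.
Proof.
move=> /mx_homogP hM; exists (M (tt, tt)); first by rewrite -(wE t).
by apply/dsP => -[[] []]; rewrite ds1E.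
Qed.

Definition scalar_model : mx_model B w :=
  MxModel (@ds1_linear _ _ _ _) scalar_mul scalar_inj scalar_homog scalar_surj.

End Trivial.

(** * The skew group algebra of the smash product as a matrix algebra *)

Section SkewModel.
Local Notation A := (skew_alg (smash_action B)).
Local Notation fm := (dirsum (G * G)%type B).

(** The image of (b e_{r,s}) delta_t, as a function of the matrix b e_{r,s}; it is
    defined on all matrices, where linear maps are determined by matrix units. *)
Definition col_shift (t : G) : fm -> fm :=
  ds_lin (fun p b => ds1 (p.1, t^-1 * p.2)%g b).

Let shift_lin (t : G) (p : G * G) :
  linear (fun b : B => ds1 (p.1, t^-1 * p.2)%g b : fm).
Proof. exact: ds1_linear. Qed.

Lemma col_shift_linear t : linear (col_shift t).
Proof. exact: ds_lin_is_linear (shift_lin t). Qed.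

Lemma col_shift1 t p b : col_shift t (ds1 p b) = ds1 (p.1, t^-1 * p.2)%g b.
Proof. exact: ds_lin1 (shift_lin t) _ _. Qed.

Lemma col_shiftE t M r q : col_shift t M (r, q) = M (r, t * q)%g.
Proof.
move: M; apply: ds_linear_ext => [c M N|c M N|[u v] b].
- by rewrite col_shift_linear dsDE dsZE.
- by rewrite dsDE dsZE.
rewrite col_shift1 !ds1E !xpair_eqE /=; congr (if _ && _ then _ else _).
by apply/eqP/eqP => [->|<-]; rewrite ?mulKg ?mulVKg.
Qed.

(** For b e_{r,u} and b' e_{p,v} both sides vanish unless u = s p, and then they are
    b b' E_{r, t^-1 v}: on the left, the shift moves v to s v and (s t)^-1 moves it
    to t^-1 v. *)
Lemma col_shift_mul s t (M N : fm) :
  col_shift (s * t)%g (mxprod M (fmx_shift s N)) =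
  mxprod (col_shift s M) (col_shift t N).
Proof.
have cL := col_shift_linear; have fL := @fmx_shift_linear G k B.
move: M; apply: ds_linear_ext => [c M M'|c M M'|p a].
- by rewrite mxprod_linl cL.
- by rewrite cL mxprod_linl.
move: N; apply: ds_linear_ext => [c N N'|c N N'|q b].
- by rewrite fL mxprod_linr cL.
- by rewrite cL mxprod_linr.
rewrite fmx_shift1 !col_shift1 !mxprod1 /=.
have -> : (p.2 == s * q.1)%g = (s^-1 * p.2 == q.1)%g.
  by apply/eqP/eqP => [->|<-]; rewrite ?mulKg ?mulVKg.
case: eqP => _; last exact: lin0 (cL _).
by rewrite col_shift1 /= invgM -mulgA mulKg.
Qed.

Definition skew_mx : A -> fm :=
  ds_lin (fun t (c : smash B) => col_shift t (smash_val c)).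

Let skew_lin (t : G) : linear (fun c : smash B => col_shift t (smash_val c)).
Proof. by move=> a c d; rewrite smash_valP col_shift_linear. Qed.

Lemma skew_mx_linear : linear skew_mx.
Proof. exact: ds_lin_is_linear skew_lin. Qed.

Lemma skew_mx1 t c : skew_mx (ds1 t c) = col_shift t (smash_val c).
Proof. exact: ds_lin1 skew_lin _ _. Qed.

Lemma skew_mxE (a : A) r q :
  skew_mx a (r, q) = \sum_(t <- finsupp a) smash_val (a t) (r, t * q)%g.
Proof. by rewrite ds_sumE; apply: eq_bigr => t _; rewrite col_shiftE. Qed.

Lemma skew_mx_mul (a b : A) : skew_mx (a * b)%g = mxprod (skew_mx a) (skew_mx b).
Proof.
have L := skew_mx_linear.
move: a; apply: ds_linear_ext => [c a a'|c a a'|s x].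
- by rewrite [(_ * b)%g]nu_linl L.
- by rewrite L mxprod_linl.
move: b; apply: ds_linear_ext => [c b b'|c b b'|t y].
- by rewrite [(_ * _)%g]nu_linr L.
- by rewrite L mxprod_linr.
rewrite [X in skew_mx X]skew_mul1 !skew_mx1 smash_valM; exact: col_shift_mul.
Qed.

(** The (r, q) entry of the image is the sum over t of the (r, t q) entries of the
    coefficients a_t.  These have degrees r^-1 t q, which differ for different t,
    so all of them vanish if the sum does. *)
Lemma skew_mx_inj (a : A) : skew_mx a = 0 -> a = 0.
Proof.
move=> a0; apply/dsP => t; rewrite ds0E; apply: val_inj; apply/dsP => -[r s].
have [ta|/ds_out ->] := boolP (t \in finsupp a); last by [].
(* The entry (r, s) of a_t contributes to the column q = t^-1 s. *)
rewrite -[s](mulVKg t) [RHS]ds0E.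
apply: (@homog_indep G _ _ _ (finsupp a) (fun u => r^-1 * (u * (t^-1 * s)))%g
  (fun u => smash_val (a u) (r, u * (t^-1 * s))%g)) ta => //.
- by move=> x y /mulgI/mulIg.
- by move=> u; case: (a u) => c /= /smash_predP; exact.
by rewrite -skew_mxE a0 ds0E.
Qed.

Lemma skew_mx_homog t (a : A) :
  a \in homog t -> skew_mx a \in mx_homog (@id G) (@id G) t.
Proof.
move=> /fsubsetP at_; apply/mx_homogP => r q; rewrite skew_mxE big_seq.
apply: homog_big => u /at_; rewrite inE => /eqP ->.
by case: (a t) => c /= /smash_predP/(_ r (t * q)%g); rewrite mulgA.
Qed.

(** A matrix of degree t has the preimage N delta_t, where N is M with its columns
    shifted back; the (r, s) entry of N has degree r^-1 t (t^-1 s), so N lies in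
    the smash product. *)
Lemma skew_mx_surj t (M : fm) : M \in mx_homog (@id G) (@id G) t ->
  exists2 a : A, a \in homog t & skew_mx a = M.
Proof.
move=> /mx_homogP hM.
have hN : col_shift t^-1 M \in @smash_pred G k B.
  apply/smash_predP => r s; rewrite col_shiftE.
  by have := hM r (t^-1 * s)%g; rewrite mulgA mulgK.
exists (ds1 t (Smash hN)); first exact: finsupp_ds1.
by rewrite skew_mx1; apply/dsP => -[r q]; rewrite !col_shiftE mulKg.
Qed.

Definition skew_model : mx_model A (@id G) :=
  MxModel skew_mx_linear skew_mx_mul skew_mx_inj skew_mx_homog skew_mx_surj.

End SkewModel.

End WeightedMatrices.

Theorem theorem3p3 (k : comPzRingType) (G : groupType)
    (B : gradedAlgType G k) (hB : idempotent_alg B) :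
  graded_equivalent B (skew_alg (smash_action B)).
Proof.
exact: (mx_models_equivalent (scalar_model B) (skew_model B) tt 1%g hB).
Qed.
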